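(* Let $\theta_0=[\mathrm{vec}(A_0)^T,\mu_0^T]^T\in\mathscr{D}(p,r)$ and suppose $M_0=M(\mu_0)$ is nonsingular. Then $$\sigma_{\min}\{D_\varphi\Sigma(\theta_0)\}\ge\begin{cases}\dfrac{2\sqrt2\,\sigma_r(M_0)(1-\|A_0\|_2^2)}{(1+\|A_0\|_2^2)^2},& r\ge2,\\[2mm] \dfrac{2\sqrt2\,\sigma_r(M_0)}{1+\|A_0\|_2^2},& r=1,\end{cases}$$ and $D\Sigma(\theta_0)^TD\Sigma(\theta_0)$ is invertible with $$\|\{D\Sigma(\theta_0)^TD\Sigma(\theta_0)\}^{-1}\|_2\le\begin{cases}1+\dfrac{(1+64\|M_0\|_2^2)(1+\|A_0\|_2^2)^4}{8\lambda_r^2(M_0)(1-\|A_0\|_2^2)^2},& r\ge2,\\[2mm] 1+\dfrac{(1+64\|M_0\|_2^2)(1+\|A_0\|_2^2)^2}{8\lambda_r^2(M_0)},& r=1.\end{cases}$$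
   Context: Fix integers $1\le r\le p$. For $A\in\mathbb{R}^{(p-r)\times r}$ write $\varphi=\mathrm{vec}(A)$ (column-stacking), $X_\varphi=\begin{bmatrix}0_{r\times r}&-A^{T}\\ A&0\end{bmatrix}$, $I_{p\times r}=\begin{bmatrix}I_r\\0\end{bmatrix}$, and let $U(\varphi)=(I_p+X_\varphi)(I_p-X_\varphi)^{-1}I_{p\times r}$ be the Cayley parameterization, with derivative $DU(\varphi)=2[I_{p\times r}^T(I_p-X_\varphi)^{-T}\otimes(I_p-X_\varphi)^{-1}]\Gamma$, $\Gamma=(I_{p^2}-K_{pp})(\Theta_1^T\otimes\Theta_2^T)$, $\Theta_1=I_{p\times r}^T$, $\Theta_2=[0_{(p-r)\times r},I_{p-r}]$; $K_{pq}$ is the commutation matrix ($\mathrm{vec}(M^T)=K_{pq}\mathrm{vec}(M)$). For a symmetric $r\times r$ matrix $M$, $\mathrm{vech}(M)\in\mathbb{R}^{r(r+1)/2}$ stacks the on-and-below-diagonal entries column by column, $M(\mu)$ is the symmetric matrix with $\mathrm{vech}(M(\mu))=\mu$, and $\mathbb{D}_r$ is the duplication matrix ($\mathrm{vec}(M)=\mathbb{D}_r\mathrm{vech}(M)$). Let $\mathscr{D}(p,r)=\{\theta=[\mathrm{vec}(A)^T,\mu^T]^T: A\in\mathbb{R}^{(p-r)\times r},\|A\|_2<1,\ \mu\in\mathbb{R}^{r(r+1)/2}\}$ and $\Sigma(\theta)=U(\varphi)M(\mu)U(\varphi)^T$. Define $D_\varphi\Sigma(\theta)=(I_{p^2}+K_{pp})\{U(\varphi)M(\mu)\otimes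 I_p\}DU(\varphi)$, $D_\mu\Sigma(\theta)=\{U(\varphi)\otimes U(\varphi)\}\mathbb{D}_r$, $D\Sigma(\theta)=[D_\varphi\Sigma(\theta),\,D_\mu\Sigma(\theta)]$. $\sigma_{\min}$ denotes the smallest singular value, $\sigma_r(M_0)$ the smallest singular value of $M_0$, and the eigenvalues of the symmetric $M_0$ are ordered by magnitude $|\lambda_1(M_0)|\ge\dots\ge|\lambda_r(M_0)|$. *)

(* Defs.v *)
(* R : realType (MathComp-Analysis), matrices from mathcomp.
   Kronecker product = mathcomp-real-closed's [tensmx] (standard Kronecker
   ordering: entry (i*p+k, j*q+l) of A *t B is A i j * B k l). *)
From HB Require Import structures.
From mathcomp Require Import all_boot all_order all_algebra.
From mathcomp Require Import mxtens.
From mathcomp Require Import all_classical all_reals ereal.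


Set Implicit Arguments.
Unset Strict Implicit.
Unset Printing Implicit Defensive.

Import Order.TTheory GRing.Theory Num.Theory.
Local Open Scope ring_scope.

Section Defs.
Variable R : realType.

Definition vnorm {n} (x : 'cV[R]_n) : R := Num.sqrt (\sum_i x i 0 ^+ 2).

Definition opnorm2 {m n} (A : 'M[R]_(m, n)) : R :=
  sup [set vnorm (A *m x) | x in [set x : 'cV[R]_n | vnorm x = 1]].

(* smallest singular value of an m x n matrix with m >= n:
   min_{||x||=1} ||B x|| (in \bar R, so that it is +oo when n = 0) *)
Definition sigma_min {m n} (B : 'M[R]_(m, n)) : \bar R :=
  ereal_inf [set (vnorm (B *m x))%:E | x in [set x : 'cV[R]_n | vnorm x = 1]].

Definition lambda_min_abs {n} (M : 'M[R]_n) : R :=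
  inf [set `|a| | a in [set a : R | eigenvalue M a]].

(* column-stacking vectorization: vec A has entry A i j at index j*m + i *)
Definition vec {m n} (A : 'M[R]_(m, n)) : 'cV[R]_(n * m) := (mxvec A^T)^T.
Definition unvec {m n} (v : 'cV[R]_(n * m)) : 'M[R]_(m, n) := (vec_mx v^T)^T.

(* commutation matrix K_{mn}: vec (M^T) = K_{mn} vec M for M : m x n *)
Definition commat (m n : nat) : 'M[R]_(m * n, n * m) :=
  \matrix_(a, b) (vec (unvec (delta_mx b (0 : 'I_1)) : 'M[R]_(m, n))^T) a 0.

Definition vechN (r : nat) : nat := (r * r.+1)./2.

(* position (0-based) in vech of the entry (i, j) with i >= j:
   sum_{k<j} (r - k) + (i - j); symmetrized via max/min *)
Definition vech_index {r} (i j : 'I_r) : nat :=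
  let c := minn i j in let d := maxn i j in
  (c * r - (c * c.-1)./2 + (d - c))%N.

Definition vech {r} (M : 'M[R]_r) : 'cV[R]_(vechN r) :=
  \col_(b < vechN r) \sum_(i < r) \sum_(j < r)
     (((j <= i)%N && (vech_index i j == b)) %:R * M i j).

(* M(mu): the symmetric matrix with vech (M mu) = mu *)
Definition Mmat {r} (mu : 'cV[R]_(vechN r)) : 'M[R]_r :=
  \matrix_(i, j) \sum_(b < vechN r) ((vech_index i j == b)%:R * mu b 0).

(* duplication matrix: vec M = D_r vech M for symmetric M *)
Definition dupmat (r : nat) : 'M[R]_(r * r, vechN r) :=
  \matrix_(a, b) (vec (Mmat (delta_mx b (0 : 'I_1)) : 'M[R]_r)) a 0.

Variables p r : nat.

Definition Ipr : 'M[R]_(p, r) :=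
  conform_mx 0 (col_mx (1%:M : 'M[R]_r) (0 : 'M[R]_(p - r, r))).
Definition Theta1 : 'M[R]_(r, p) := Ipr^T.
Definition Theta2 : 'M[R]_(p - r, p) :=
  conform_mx 0 (row_mx (0 : 'M[R]_(p - r, r)) (1%:M : 'M[R]_(p - r))).

Definition Xphi (A : 'M[R]_(p - r, r)) : 'M[R]_p :=
  conform_mx 0 (block_mx (0 : 'M[R]_r) (- A^T) A (0 : 'M[R]_(p - r))).

Definition Ucay (A : 'M[R]_(p - r, r)) : 'M[R]_(p, r) :=
  (1%:M + Xphi A) *m invmx (1%:M - Xphi A) *m Ipr.

Definition Gamma : 'M[R]_(p * p, r * (p - r)) :=
  (1%:M - commat p p) *m (Theta1^T *t Theta2^T).

Definition DU (A : 'M[R]_(p - r, r)) : 'M[R]_(r * p, r * (p - r)) :=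
  2%:R *: ((Ipr^T *m (invmx (1%:M - Xphi A))^T) *t invmx (1%:M - Xphi A))
    *m Gamma.

Definition DphiSigma (A : 'M[R]_(p - r, r)) (mu : 'cV[R]_(vechN r))
  : 'M[R]_(p * p, r * (p - r)) :=
  (1%:M + commat p p) *m ((Ucay A *m Mmat mu) *t (1%:M : 'M[R]_p)) *m DU A.

Definition DmuSigma (A : 'M[R]_(p - r, r)) : 'M[R]_(p * p, vechN r) :=
  (Ucay A *t Ucay A) *m dupmat r.

Definition DSigma (A : 'M[R]_(p - r, r)) (mu : 'cV[R]_(vechN r))
  : 'M[R]_(p * p, r * (p - r) + vechN r) :=
  row_mx (DphiSigma A mu) (DmuSigma A).

End Defs.

(* Main.v *)
Require Import Defs.
From HB Require Import structures.
From mathcomp Require Import all_boot all_order all_algebra.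
From mathcomp Require Import mxtens.
From mathcomp Require Import all_classical all_reals ereal.
From mathcomp Require Import zify ring lra.

(* Let E = [I_r; 0], T = Theta2, C = (I - X)^-1, and let Q = (I + X) C be the
   Cayley transform, which is orthogonal, so that U = Q E. Conjugating by Q
   turns the derivative of Sigma in the direction (B, m) into
     G E^T + E G^T + E M(m) E^T,  G = Z E M_0,  Z = 2 C^T X_B C,
   with diagonal block E^T G + G^T E + M(m) and off-diagonal block T G.
   Everything rests on the off-diagonal block W = T C^T X_B C E, for which
     (I + A A^T) W (I + A^T A) = B + A B^T A;
   this gives |W| >= (1 - a) / (1 + a)^2 |B| with a = |A|^2, and
   |W| = |B| / (1 + a) when r = 1. The diagonal block controls m up to
   8 |M_0| |B|, and Cauchy-Schwarz combines the two. *)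

Set Implicit Arguments.
Unset Strict Implicit.
Unset Printing Implicit Defensive.

Import Order.TTheory GRing.Theory Num.Theory.
Local Open Scope ring_scope.

(** * Frobenius inner product and norm *)

Section Frobenius.
Variable R : realType.
Implicit Types m n k : nat.

Definition frob_dot {m n} (A B : 'M[R]_(m, n)) : R := \tr (A^T *m B).
Definition frob {m n} (A : 'M[R]_(m, n)) : R := Num.sqrt (frob_dot A A).

Lemma frob_dotE m n (A B : 'M[R]_(m, n)) :
  frob_dot A B = \sum_j \sum_i A i j * B i j.
Proof.
by apply: eq_bigr => j _; rewrite mxE; apply: eq_bigr => i _; rewrite mxE.
Qed.

Lemma frob_dotC m n (A B : 'M[R]_(m, n)) : frob_dot A B = frob_dot B A.
Proof. by rewrite /frob_dot -mxtrace_tr trmx_mul trmxK. Qed.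

Lemma frob_dotDl m n (A B C : 'M[R]_(m, n)) :
  frob_dot (A + B) C = frob_dot A C + frob_dot B C.
Proof. by rewrite /frob_dot raddfD mulmxDl mxtraceD. Qed.

Lemma frob_dotZl m n a (A B : 'M[R]_(m, n)) :
  frob_dot (a *: A) B = a * frob_dot A B.
Proof. by rewrite /frob_dot linearZ -scalemxAl mxtraceZ. Qed.

Lemma frob_dotDr m n (A B C : 'M[R]_(m, n)) :
  frob_dot A (B + C) = frob_dot A B + frob_dot A C.
Proof. by rewrite frob_dotC frob_dotDl !(frob_dotC A). Qed.

Lemma frob_dotZr m n a (A B : 'M[R]_(m, n)) :
  frob_dot A (a *: B) = a * frob_dot A B.
Proof. by rewrite frob_dotC frob_dotZl frob_dotC. Qed.

Lemma frob_dotNr m n (A B : 'M[R]_(m, n)) : frob_dot A (- B) = - frob_dot A B.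
Proof. by rewrite -scaleN1r frob_dotZr mulN1r. Qed.

Lemma frob_dotMl m n k (L : 'M[R]_(m, n)) (A : 'M[R]_(n, k)) (B : 'M[R]_(m, k)) :
  frob_dot (L *m A) B = frob_dot A (L^T *m B).
Proof. by rewrite /frob_dot trmx_mul mulmxA. Qed.

Lemma frob_dotMr m n k (A : 'M[R]_(m, n)) (L : 'M[R]_(n, k)) (B : 'M[R]_(m, k)) :
  frob_dot (A *m L) B = frob_dot A (B *m L^T).
Proof. by rewrite /frob_dot trmx_mul -mulmxA mxtrace_mulC mulmxA. Qed.

Lemma frob_dot_tr m n (A B : 'M[R]_(m, n)) : frob_dot A^T B^T = frob_dot A B.
Proof. by rewrite /frob_dot -mxtrace_tr trmx_mul !trmxK mxtrace_mulC. Qed.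

Lemma frob_dot_ge0 m n (A : 'M[R]_(m, n)) : 0 <= frob_dot A A.
Proof.
by rewrite frob_dotE; do 2!(apply: sumr_ge0 => ? _); rewrite -expr2 sqr_ge0.
Qed.

Lemma frob_dot_eq0 m n (A : 'M[R]_(m, n)) : (frob_dot A A == 0) = (A == 0).
Proof.
apply/eqP/eqP => [|->]; last by rewrite /frob_dot mulmx0 mxtrace0.
rewrite frob_dotE => /eqP; rewrite psumr_eq0; last first.
  by move=> j _; apply: sumr_ge0 => i _; rewrite -expr2 sqr_ge0.
move=> /allP A0; apply/matrixP => i j; rewrite mxE.
have := A0 j (mem_index_enum j); rewrite /= psumr_eq0; last first.
  by move=> ? _; rewrite -expr2 sqr_ge0.
by move=> /allP /(_ i (mem_index_enum i)); rewrite /= mulf_eq0 orbb => /eqP.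
Qed.

(** The form is nonnegative at [x + t *: y] for every [t], so this quadratic in [t] has nonpositive
    discriminant. The form may be degenerate, hence the separate case of a vanishing leading
    coefficient. *)
Lemma psd_CauchySchwarz m n (S : 'M[R]_m) (x y : 'M[R]_(m, n)) :
  S^T = S -> (forall z : 'M[R]_(m, n), 0 <= frob_dot z (S *m z)) ->
  frob_dot x (S *m y) ^+ 2 <= frob_dot x (S *m x) * frob_dot y (S *m y).
Proof.
move=> Ssym Spsd.
have q t : 0 <= frob_dot x (S *m x) + 2 * t * frob_dot x (S *m y)
    + t ^+ 2 * frob_dot y (S *m y).
  have := Spsd (x + t *: y).
  rewrite mulmxDr -scalemxAr frob_dotDl !frob_dotDr !frob_dotZl !frob_dotZr.
  have -> : frob_dot y (S *m x) = frob_dot x (S *m y).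
    by rewrite frob_dotC frob_dotMl Ssym.
  by move=> h; apply: le_trans h _; lra.
set a := frob_dot x _ in q *; set b := frob_dot x _ in q *.
have c0 : 0 <= frob_dot y (S *m y) by exact: Spsd.
set c := frob_dot y _ in q c0 *.
have [c00|cn0] := eqVneq c 0.
  have [-> | bn0] := eqVneq b 0; first by rewrite c00 mulr0 expr0n.
  (* With [c = 0] the polynomial is affine in [t]; at this [t] it equals -1, a contradiction. *)
  have := q (- (a + 1) / (2 * b)).
  rewrite c00 mulr0 addr0 (_ : 2 * _ * b = - (a + 1)); first by lra.
  by field.
have cp : 0 < c by rewrite lt0r cn0.
rewrite -subr_ge0.
(* The value [- b / c] minimizes the quadratic. *)
have -> : a * c - b ^+ 2 = (a + 2 * (- b / c) * b + (- b / c) ^+ 2 * c) * c.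
  by field.
by rewrite mulr_ge0.
Qed.

Lemma frob_ge0 m n (A : 'M[R]_(m, n)) : 0 <= frob A.
Proof. exact: sqrtr_ge0. Qed.

Lemma sqr_frob m n (A : 'M[R]_(m, n)) : frob A ^+ 2 = frob_dot A A.
Proof. by rewrite sqr_sqrtr ?frob_dot_ge0. Qed.

Lemma frob_eq0 m n (A : 'M[R]_(m, n)) : (frob A == 0) = (A == 0).
Proof. by rewrite -sqrf_eq0 sqr_frob frob_dot_eq0. Qed.

Lemma frob0 m n : frob (0 : 'M[R]_(m, n)) = 0.
Proof. by apply/eqP; rewrite frob_eq0. Qed.

Lemma frob_gt0 m n (A : 'M[R]_(m, n)) : A != 0 -> 0 < frob A.
Proof. by move=> A0; rewrite lt0r frob_eq0 A0 frob_ge0. Qed.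

Lemma frob_tr m n (A : 'M[R]_(m, n)) : frob A^T = frob A.
Proof. by rewrite /frob frob_dot_tr. Qed.

Lemma frobZ m n a (A : 'M[R]_(m, n)) : frob (a *: A) = `|a| * frob A.
Proof.
by rewrite /frob frob_dotZl frob_dotZr mulrA -expr2 sqrtrM ?sqr_ge0 // sqrtr_sqr.
Qed.

Lemma frobN m n (A : 'M[R]_(m, n)) : frob (- A) = frob A.
Proof. by rewrite -scaleN1r frobZ normrN1 mul1r. Qed.

Lemma frob_CauchySchwarz m n (A B : 'M[R]_(m, n)) :
  frob_dot A B <= frob A * frob B.
Proof.
apply: (le_trans (ler_norm _)).
rewrite -ler_sqr ?nnegrE ?mulr_ge0 ?frob_ge0 // real_normK ?num_real //.
rewrite exprMn !sqr_frob; have := psd_CauchySchwarz (S := 1%:M) A B (trmx1 _ _).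
by rewrite !mul1mx; apply => z; rewrite mul1mx frob_dot_ge0.
Qed.

Lemma ler_frobD m n (A B : 'M[R]_(m, n)) : frob (A + B) <= frob A + frob B.
Proof.
rewrite -ler_sqr ?nnegrE ?addr_ge0 ?frob_ge0 // sqrrD !sqr_frob.
rewrite frob_dotDl !frob_dotDr (frob_dotC B A).
by have := frob_CauchySchwarz A B; lra.
Qed.

Lemma sqr_frob_col m n (A : 'M[R]_(m, n)) :
  frob A ^+ 2 = \sum_j frob (col j A) ^+ 2.
Proof.
rewrite sqr_frob frob_dotE; apply: eq_bigr => j _.
rewrite sqr_frob frob_dotE big_ord1; apply: eq_bigr => i _; by rewrite !mxE.
Qed.

Lemma frob_mulmx_le m n k (L : 'M[R]_(m, n)) c (B : 'M[R]_(n, k)) :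
  0 <= c -> (forall x : 'cV[R]_n, frob (L *m x) <= c * frob x) ->
  frob (L *m B) <= c * frob B.
Proof.
move=> c0 Lc; rewrite -ler_sqr ?nnegrE ?mulr_ge0 ?frob_ge0 //.
rewrite exprMn !sqr_frob_col mulr_sumr; apply: ler_sum => j _.
rewrite -exprMn ler_sqr ?nnegrE ?mulr_ge0 ?frob_ge0 //.
by rewrite !colE -mulmxA Lc.
Qed.

Lemma frob_mulmx_ge m n k (L : 'M[R]_(m, n)) c (B : 'M[R]_(n, k)) :
  0 <= c -> (forall x : 'cV[R]_n, c * frob x <= frob (L *m x)) ->
  c * frob B <= frob (L *m B).
Proof.
move=> c0 Lc; rewrite -ler_sqr ?nnegrE ?mulr_ge0 ?frob_ge0 //.
rewrite exprMn !sqr_frob_col mulr_sumr; apply: ler_sum => j _.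
rewrite -exprMn ler_sqr ?nnegrE ?mulr_ge0 ?frob_ge0 //.
by rewrite !colE -mulmxA Lc.
Qed.

Lemma frob_rank1 m n (y : 'cV[R]_m) (x : 'cV[R]_n) :
  frob (y *m x^T) = frob y * frob x.
Proof.
rewrite /frob -sqrtrM ?frob_dot_ge0 // frob_dotMr trmxK -mulmxA.
rewrite [x^T *m x]mx11_scalar mul_mx_scalar frob_dotZr mulrC; congr (Num.sqrt (_ * _)).
by rewrite frob_dotE big_ord1 mxE; apply: eq_bigr => i _; rewrite mxE.
Qed.

(** Columnwise, |Ax|^2 is the inner product of A with the rank-one matrix (Ax)x^T; Cauchy-Schwarz
    gives at most |A| |Ax| |x|, and |Ax| cancels. *)
Lemma frob_mulmx m n k (A : 'M[R]_(m, n)) (B : 'M[R]_(n, k)) :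
  frob (A *m B) <= frob A * frob B.
Proof.
apply: frob_mulmx_le => [|x]; first exact: frob_ge0.
have [->|Ax0] := eqVneq (A *m x) 0.
  by rewrite frob0 mulr_ge0 ?frob_ge0.
rewrite -(ler_pM2r (frob_gt0 Ax0)) -expr2 sqr_frob frob_dotMr -mulrA.
by rewrite (mulrC (frob x)) -frob_rank1 frob_CauchySchwarz.
Qed.

Lemma unitmx_injective n (S : 'M[R]_n) :
  (forall x : 'cV[R]_n, S *m x = 0 -> x = 0) -> S \in unitmx.
Proof.
move=> Sinj; rewrite -unitmx_tr -row_free_unit -kermx_eq0.
apply/eqP/row_matrixP => i; rewrite row0; apply: trmx_inj; rewrite trmx0.
apply: Sinj; apply: trmx_inj; rewrite trmx_mul trmxK trmx0.
by rewrite -row_mul mulmx_ker row0.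
Qed.

End Frobenius.

(** * Operator norm, smallest singular value and smallest eigenvalue modulus *)

Section OperatorNorm.
Variable R : realType.
Implicit Types m n : nat.

Lemma vnormE n (x : 'cV[R]_n) : vnorm x = frob x.
Proof.
by rewrite /vnorm /frob frob_dotE big_ord1; congr Num.sqrt; apply: eq_bigr.
Qed.

Lemma unit_vector n (x : 'cV[R]_n) : x != 0 -> frob ((frob x)^-1 *: x) = 1.
Proof.
move=> x0; have x_gt0 := frob_gt0 x0.
by rewrite frobZ ger0_norm ?invr_ge0 ?frob_ge0 // mulVf // gt_eqF.
Qed.

Lemma opnorm2_bound m n (A : 'M[R]_(m, n)) (x : 'cV[R]_n) :
  frob (A *m x) <= opnorm2 A * frob x.
Proof.
have [->|x0] := eqVneq x 0; first by rewrite mulmx0 !frob0 mulr0.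
have x_gt0 := frob_gt0 x0.
rewrite -ler_pdivrMr // mulrC.
rewrite -[(frob x)^-1]ger0_norm ?invr_ge0 ?frob_ge0 // -frobZ scalemxAr.
apply: ub_le_sup.
  (* [sup] dominates the members of a bounded set only; the Frobenius norm supplies the bound. *)
  exists (frob A) => _ [y y1 <-]; rewrite vnormE.
  by apply: le_trans (frob_mulmx A y) _; rewrite -[frob y]vnormE y1 mulr1.
by exists ((frob x)^-1 *: x); rewrite /= ?vnormE ?unit_vector.
Qed.

Lemma opnorm2_le m n (A : 'M[R]_(m, n)) c :
  0 <= c -> (forall x : 'cV[R]_n, frob (A *m x) <= c * frob x) -> opnorm2 A <= c.
Proof.
move=> c0 Ac; rewrite /opnorm2.
(* In dimension 0 there is no unit vector, and [sup] of the empty set is 0. *)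
set S := (X in sup X); have [->|S0] := eqVneq S classical_sets.set0.
  by rewrite sup0.
apply: ge_sup; first exact/classical_sets.set0P.
move=> _ [x x1 <-].
by rewrite vnormE (le_trans (Ac x)) // -vnormE x1 mulr1.
Qed.

Lemma opnorm2_ge0 m n (A : 'M[R]_(m, n)) : 0 <= opnorm2 A.
Proof.
rewrite /opnorm2; set S := (X in sup X).
have [->|S0] := eqVneq S classical_sets.set0; first by rewrite sup0.
have /classical_sets.set0P [_ [x x1 _]] := S0.
have := opnorm2_bound A x; rewrite -!vnormE x1 mulr1.
by apply: le_trans; rewrite sqrtr_ge0.
Qed.

Lemma opnorm2_mulmx m n k (A : 'M[R]_(m, n)) (B : 'M[R]_(n, k)) :
  frob (A *m B) <= opnorm2 A * frob B.
Proof. exact: frob_mulmx_le (opnorm2_ge0 A) (opnorm2_bound A). Qed.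

(** By duality, |A^T B|^2 = <B, A A^T B> is at most |B| times the operator norm of A times |A^T B|;
    one factor cancels. *)
Lemma opnorm2_trmx_mulmx m n k (A : 'M[R]_(m, n)) (B : 'M[R]_(m, k)) :
  frob (A^T *m B) <= opnorm2 A * frob B.
Proof.
have [->|AB0] := eqVneq (A^T *m B) 0.
  by rewrite frob0 mulr_ge0 ?opnorm2_ge0 ?frob_ge0.
rewrite -(ler_pM2r (frob_gt0 AB0)) -expr2 sqr_frob frob_dotMl trmxK.
apply: le_trans (frob_CauchySchwarz _ _) _.
by rewrite mulrAC mulrC ler_wpM2r ?frob_ge0 // opnorm2_mulmx.
Qed.

Lemma opnorm2_mulmxr m n k (A : 'M[R]_(m, n)) (B : 'M[R]_(k, m)) :
  frob (B *m A) <= opnorm2 A * frob B.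
Proof. by rewrite -frob_tr trmx_mul -(frob_tr B) opnorm2_trmx_mulmx. Qed.

Lemma sigma_min_le n m (B : 'M[R]_(m, n)) (x : 'cV[R]_n) :
  (0 < n)%N -> fine (sigma_min B) * frob x <= frob (B *m x).
Proof.
move=> n0.
have [->|x0] := eqVneq x 0; first by rewrite mulmx0 !frob0 mulr0.
have x_gt0 := frob_gt0 x0; rewrite -ler_pdivlMr // mulrC.
rewrite -[(frob x)^-1]ger0_norm ?invr_ge0 ?frob_ge0 // -frobZ scalemxAr.
set y := _ *: x; have y1 : vnorm y = 1 by rewrite vnormE unit_vector.
have ge0 : (0 <= sigma_min B)%E.
  by apply: le_ereal_inf_tmp => _ [z _ <-]; rewrite lee_fin sqrtr_ge0.
have le : (sigma_min B <= (frob (B *m y))%:E)%E.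
  by apply: ereal_inf_lbound; exists y; rewrite ?vnormE.
by rewrite -lee_fin fineK // ge0_fin_numE // (le_lt_trans le) ?ltry.
Qed.

Lemma sigma_min_ge n m (B : 'M[R]_(m, n)) c :
  (forall x : 'cV[R]_n, c * frob x <= frob (B *m x)) -> (c%:E <= sigma_min B)%E.
Proof.
move=> cB; apply: le_ereal_inf_tmp => _ [x x1 <-].
by rewrite lee_fin vnormE (le_trans _ (cB x)) // -vnormE x1 mulr1.
Qed.

Lemma fine_sigma_min_ge n m (B : 'M[R]_(m, n)) c : (0 < n)%N ->
  (forall x : 'cV[R]_n, c * frob x <= frob (B *m x)) -> c <= fine (sigma_min B).
Proof.
case: n B => // n B _ cB.
have := sigma_min_ge cB; have : (sigma_min B < +oo)%E.
  (* Positive width provides a unit vector, so the infimum is not [+oo] and [fine] does not send it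
     to 0. *)
  pose x : 'cV[R]_n.+1 := delta_mx 0 0.
  have x0 : x != 0.
    by apply/eqP => /matrixP /(_ 0 0) /eqP; rewrite !mxE !eqxx oner_eq0.
  apply: le_lt_trans (ltry (vnorm (B *m ((frob x)^-1 *: x)))).
  apply: ereal_inf_lbound.
  by exists ((frob x)^-1 *: x); rewrite //= vnormE unit_vector.
by case: (sigma_min B).
Qed.

Lemma fine_sigma_min_ge0 n m (B : 'M[R]_(m, n)) :
  (0 < n)%N -> 0 <= fine (sigma_min B).
Proof. by move=> n0; apply: fine_sigma_min_ge => // x; rewrite mul0r frob_ge0. Qed.

Lemma fine_sigma_min_gt0 n (M : 'M[R]_n) :
  (0 < n)%N -> M \in unitmx -> 0 < fine (sigma_min M).
Proof.
move=> n0 Mu; set c := frob (invmx M) + 1.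
have c0 : 0 < c by rewrite ltr_wpDl ?frob_ge0.
apply: lt_le_trans (fine_sigma_min_ge (c := c^-1) n0 _); first by rewrite invr_gt0.
move=> x; rewrite mulrC ler_pdivrMr // mulrC.
rewrite -{1}[x](mulKmx Mu); apply: le_trans (frob_mulmx _ _) _.
by rewrite ler_wpM2r ?frob_ge0 // /c lerDl.
Qed.

(* If M^2 - s^2 were invertible with s the smallest singular value, applying
   Cauchy-Schwarz to this positive semidefinite form would bound
   |M x|^2 - s^2 |x|^2 below by a positive multiple of |x|^2. *)
Lemma sqr_sigma_min_singular n (M : 'M[R]_n) : (0 < n)%N -> M^T = M ->
  M *m M - (fine (sigma_min M) ^+ 2)%:M \notin unitmx.
Proof.
move=> n0 Msym; set s := fine (sigma_min M); set S := _ - _; apply/negP => Su.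
have s0 : 0 <= s by exact: fine_sigma_min_ge0.
have dotS (x : 'cV[R]_n) :
    frob_dot x (S *m x) = frob (M *m x) ^+ 2 - s ^+ 2 * frob x ^+ 2.
  rewrite mulmxBl frob_dotDr frob_dotNr mul_scalar_mx frob_dotZr -mulmxA.
  by rewrite !sqr_frob frob_dotMl Msym.
have Spsd (x : 'cV[R]_n) : 0 <= frob_dot x (S *m x).
  rewrite dotS subr_ge0 -exprMn ler_sqr ?nnegrE ?mulr_ge0 ?frob_ge0 //.
  exact: sigma_min_le.
have Ssym : S^T = S by rewrite linearB /= trmx_mul Msym tr_scalar_mx.
(* The constant combines |x| <= |S^-1| |Sx| with |Sx|^2 <= |S| <x, Sx>, the latter from
   Cauchy-Schwarz for the form at Sx and x. The added ones keep it positive. *)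
pose k := (frob S + 1) * (frob (invmx S) + 1) ^+ 2.
have S1 : 0 < frob S + 1 by rewrite ltr_wpDl ?frob_ge0.
have S'1 : 0 < frob (invmx S) + 1 by rewrite ltr_wpDl ?frob_ge0.
have k0 : 0 < k by rewrite mulr_gt0 // exprn_gt0.
have dotS_ge (x : 'cV[R]_n) : frob x ^+ 2 <= k * frob_dot x (S *m x).
  have [->|Sx0] := eqVneq x 0.
    by rewrite frob0 expr0n /= mulr_ge0 ?Spsd // ltW.
  have x_gt0 := frob_gt0 Sx0.
  have le1 : frob x <= (frob (invmx S) + 1) * frob (S *m x).
    rewrite -{1}[x](mulKmx Su); apply: le_trans (frob_mulmx _ _) _.
    by rewrite ler_wpM2r ?frob_ge0 // lerDl.
  have y_gt0 : 0 < frob (S *m x).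
    by rewrite -(pmulr_rgt0 _ S'1) (lt_le_trans x_gt0).
  have le2 : frob (S *m x) ^+ 2 <= (frob S + 1) * frob_dot x (S *m x).
    have := psd_CauchySchwarz (S *m x) x Ssym Spsd.
    rewrite -sqr_frob => cs.
    have : frob_dot (S *m x) (S *m (S *m x)) <= (frob S + 1) * frob (S *m x) ^+ 2.
      apply: le_trans (frob_CauchySchwarz _ _) _.
      rewrite expr2 mulrCA ler_wpM2l ?frob_ge0 //.
      by apply: le_trans (frob_mulmx _ _) _; rewrite ler_wpM2r ?frob_ge0 // lerDl.
    move=> h; rewrite -(ler_pM2r (exprn_gt0 2 y_gt0)) -expr2.
    apply: le_trans cs _; rewrite mulrAC.
    by apply: ler_wpM2r => //; exact: Spsd.
  apply: (@le_trans _ _ ((frob (invmx S) + 1) ^+ 2 * frob (S *m x) ^+ 2)).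
    rewrite -exprMn ler_sqr ?nnegrE ?frob_ge0 //.
    by rewrite mulr_ge0 ?frob_ge0 // ltW.
  by rewrite [k * _]mulrAC [leLHS]mulrC ler_wpM2r ?sqr_ge0.
(* This [t] exceeds [s], yet [dotS_ge] makes it a lower bound of |Mx| / |x|. *)
pose t := Num.sqrt (s ^+ 2 + k^-1).
have t2 : t ^+ 2 = s ^+ 2 + k^-1.
  by rewrite sqr_sqrtr // addr_ge0 ?sqr_ge0 // invr_ge0 ltW.
have t0 : 0 <= t by exact: sqrtr_ge0.
have : t <= s.
  apply: fine_sigma_min_ge => // x.
  rewrite -ler_sqr ?nnegrE ?mulr_ge0 ?frob_ge0 // exprMn t2 mulrDl.
  have := dotS_ge x; rewrite dotS mulrC -ler_pdivrMr // mulrC.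
  lra.
rewrite -ler_sqr ?nnegrE // t2 gerDl leNgt invr_gt0.
by rewrite k0.
Qed.

Lemma eigenvalue_singular n (M : 'M[R]_n) a :
  M - a%:M \notin unitmx -> eigenvalue M a.
Proof.
by rewrite -row_free_unit -kermx_eq0 /eigenvalue /eigenspace.
Qed.

(** The factorization M^2 - s^2 = (M - s)(M + s) of a singular matrix makes s or -s an eigenvalue,
    while any eigenvector shows that its eigenvalue has modulus at least s. *)
Lemma lambda_min_absE n (M : 'M[R]_n) : (0 < n)%N -> M^T = M ->
  lambda_min_abs M = fine (sigma_min M).
Proof.
move=> n0 Msym; set s := fine _.
have s0 : 0 <= s by exact: fine_sigma_min_ge0.
have ev_ge a : eigenvalue M a -> s <= `|a|.
  move=> /eigenvalueP [v vM v0]; have vT0 : v^T != 0 by rewrite trmx_eq0.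
  rewrite -(ler_pM2r (frob_gt0 vT0)) -frobZ -linearZ /= -vM trmx_mul Msym.
  exact: sigma_min_le.
have [b bM bs] : exists2 b, eigenvalue M b & `|b| = s.
  have := sqr_sigma_min_singular n0 Msym; rewrite -/s.
  have -> : M *m M - (s ^+ 2)%:M = (M - s%:M) *m (M - (- s)%:M).
    rewrite mulmxBl !mulmxBr !mul_scalar_mx mul_mx_scalar scale_scalar_mx mulrN.
    by rewrite raddfN /= scaleNr !opprK opprD addrA addrK expr2.
  rewrite unitmx_mul negb_and => /orP [] /eigenvalue_singular h.
    by exists s => //; rewrite ger0_norm.
  by exists (- s) => //; rewrite normrN ger0_norm.
apply/eqP; rewrite eq_le; apply/andP; split.
  rewrite -bs; apply: ge_inf; last by exists b.
  by exists 0 => _ [a _ <-].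
apply: lb_le_inf; first by exists `|b|, b.
by move=> _ [a aM <-]; exact: ev_ge.
Qed.

End OperatorNorm.

(** * Agreement of the [mxvec] and Kronecker index conventions *)

Lemma index_allpairs_pair (T U : eqType) (s : seq T) (t : seq U) x y :
  x \in s -> y \in t ->
  index (x, y) [seq (a, b) | a <- s, b <- t] = (index x s * size t + index y t)%N.
Proof.
move=> + yt; elim: s => // a s IH; rewrite inE allpairs_cons index_cat.
have pair_inj (z : T) : injective (fun b : U => (z, b)) by move=> ? ? [].
have [->|xa] /= := eqVneq x a => [_|xs].
  by rewrite map_f // index_map // eqxx.
rewrite ifN; last by apply/mapP => -[b _ [xa']]; rewrite xa' eqxx in xa.
by rewrite eq_sym (negPf xa) IH // size_map mulSn addnA.
Qed.

(** [mxvec] numbers entries by the enumeration of a product type, [tensmx] by an arithmetic formula;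
    both orders are lexicographic. This lets [vec] interact with Kronecker products. *)
Lemma mxvec_indexE m n (i : 'I_m) (j : 'I_n) : mxvec_index i j = mxtens_index (i, j).
Proof.
apply: val_inj => /=.
have -> : enum_rank (i, j) = index (i, j) (enum {: 'I_m * 'I_n}) :> nat.
  rewrite -[in RHS](enum_rankK (i, j)) (enum_val_nth (i, j)).
  by rewrite index_uniq ?enum_uniq // -cardE.
rewrite enumT unlock /= index_allpairs_pair ?mem_enum //.
by rewrite !index_enum_ord size_enum_ord.
Qed.

(** * Vectorization, commutation and duplication matrices, half-vectorization *)

Section Vectorization.
Variable R : realType.
Implicit Types m n : nat.

Lemma vecE m n (A : 'M[R]_(m, n)) i j : vec A (mxtens_index (j, i)) 0 = A i j.
Proof. by rewrite -mxvec_indexE mxE mxvecE mxE. Qed.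

Lemma unvecK m n (v : 'cV[R]_(n * m)) : vec (unvec v : 'M[R]_(m, n)) = v.
Proof. by rewrite /vec /unvec trmxK vec_mxK trmxK. Qed.

Lemma vecK m n (A : 'M[R]_(m, n)) : unvec (vec A) = A.
Proof. by rewrite /vec /unvec trmxK mxvecK trmxK. Qed.

Lemma vec_linear m n : linear (@vec R m n).
Proof. by move=> a A B; rewrite /vec !linearP. Qed.

HB.instance Definition _ m n := GRing.isLinear.Build R 'M[R]_(m, n) 'cV[R]_(n * m) _
  (@vec R m n) (@vec_linear m n).

Lemma unvec_linear m n : linear (@unvec R m n).
Proof. by move=> a A B; rewrite /unvec !linearP. Qed.

HB.instance Definition _ m n := GRing.isLinear.Build R 'cV[R]_(n * m) 'M[R]_(m, n) _
  (@unvec R m n) (@unvec_linear m n).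

Lemma frob_vec m n (A : 'M[R]_(m, n)) : frob (vec A) = frob A.
Proof.
rewrite /frob !frob_dotE big_ord1 pair_big /=; congr Num.sqrt.
rewrite (reindex (@mxtens_index n m)) /=; last first.
  by exists (@mxtens_unindex n m) => ? _; rewrite (mxtens_indexK, mxtens_unindexK).
by apply: eq_bigr => -[j i] _; rewrite vecE.
Qed.

Lemma tensmx_vec m n k l (A : 'M[R]_(k, n)) (B : 'M[R]_(l, m)) (X : 'M[R]_(m, n)) :
  (A *t B) *m vec X = vec (B *m X *m A^T).
Proof.
apply/matrixP => a z; rewrite ord1 {z}.
case: (mxtens_indexP a) => i j; rewrite vecE !mxE.
rewrite (reindex (@mxtens_index n m)) /=; last first.
  by exists (@mxtens_unindex n m) => ? _; rewrite (mxtens_indexK, mxtens_unindexK).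
under [RHS]eq_bigr => u _ do rewrite !mxE mulr_suml.
rewrite pair_big /=; apply: eq_bigr => -[u v] _.
by rewrite tensmxE vecE mulrC [A i u * _]mulrC mulrA (mulrC (X v u)).
Qed.

(** [commat] and [dupmat] are both defined by the images of the basis vectors; linearity recovers
    their action on every vector. *)
Lemma mulmx_lin_basis m n (f : {linear 'cV[R]_n -> 'cV[R]_m}) (x : 'cV[R]_n) :
  (\matrix_(a < m, b < n) f (delta_mx b 0) a 0) *m x = f x.
Proof.
rewrite {2}(matrix_sum_delta x) linear_sum; apply/matrixP => a z; rewrite ord1.
rewrite !mxE summxE; apply: eq_bigr => b _.
by rewrite big_ord1 linearZ /= !mxE mulrC.
Qed.

Lemma commat_vec m n (A : 'M[R]_(m, n)) : commat R m n *m vec A = vec A^T.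
Proof.
pose f := [the {linear 'cV[R]_(n * m) -> 'cV[R]_(m * n)} of
  @vec R n m \o @trmx R m n \o @unvec R m n].
by have := mulmx_lin_basis f (vec A); rewrite /= vecK.
Qed.

Lemma Mmat_linear r : linear (@Mmat R r).
Proof.
move=> a u v; apply/matrixP => i j; rewrite !mxE mulr_sumr -big_split /=.
by apply: eq_bigr => b _; rewrite !mxE mulrDr mulrCA.
Qed.

HB.instance Definition _ r := GRing.isLinear.Build R 'cV[R]_(vechN r) 'M[R]_r _
  (@Mmat R r) (@Mmat_linear r).

Lemma dupmat_vech r (mu : 'cV[R]_(vechN r)) : dupmat R r *m mu = vec (Mmat mu).
Proof.
exact: (mulmx_lin_basis [the {linear 'cV[R]_(vechN r) -> 'cV[R]_(r * r)} of
  @vec R r r \o @Mmat R r]).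
Qed.

Lemma Mmat_tr r (mu : 'cV[R]_(vechN r)) : (Mmat mu)^T = Mmat mu.
Proof.
apply/matrixP => i j; rewrite !mxE; apply: eq_bigr => b _.
by rewrite /vech_index minnC maxnC.
Qed.

Lemma vech_index_surj r (b : nat) : (b < vechN r)%N ->
  exists i j : 'I_r, vech_index i j = b.
Proof.
(* [f c] is the number of entries in the first [c] columns of the lower triangle, hence the offset
   of column [c]. *)
pose f c := (c * r - (c * c.-1)./2)%N => b_lt.
have fS c : (c < r)%N -> f c.+1 = (f c + (r - c))%N.
  rewrite /f /= => cr.
  have -> : (c.+1 * c)./2 = ((c * c.-1)./2 + c)%N.
    have -> : (c.+1 * c = c * c.-1 + c.*2)%N by case: (c) => //= k; nia.
    by rewrite halfD odd_double andbF doubleK.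
  have : ((c * c.-1)./2 <= c * r)%N.
    by have := leq_half_double (c * c.-1) (c * r); nia.
  by nia.
have [c [cr fc bc]] : exists c, [/\ (c < r)%N, (f c <= b)%N & (b < f c.+1)%N].
  have fr : (b < f r)%N.
    apply: leq_trans b_lt _; rewrite /vechN /f.
    have : (r * r.+1 = r * r.-1 + r.*2)%N by case: (r) => //= k; nia.
    move=> ->; rewrite halfD odd_double andbF doubleK.
    have := halfK (r * r.-1).
    case: (r) => //= k; nia.
  have : exists c, (b < f c)%N by exists r.
  (* The least index whose offset exceeds [b] is positive; its predecessor is the column containing
     position [b]. *)
  case/ex_minnP => -[|c]; first by rewrite /f mul0n.
  move=> bc cmin; exists c; split => //; first exact: cmin.
  by rewrite leqNgt; apply/negP => /cmin; rewrite ltnn.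
have dr : (c + (b - f c) < r)%N by have := fS c cr; lia.
exists (Ordinal dr), (Ordinal cr); rewrite /vech_index /=.
rewrite (minn_idPr _) ?(maxn_idPl _) ?leq_addr //.
by rewrite -/(f c); lia.
Qed.

(** Every coordinate of [mu] occupies at least one entry by [vech_index_surj], and no entry mixes
    two coordinates, so the sum of squares can only grow. *)
Lemma frob_Mmat_ge r (mu : 'cV[R]_(vechN r)) : frob mu <= frob (Mmat mu).
Proof.
rewrite /frob ler_sqrt ?frob_dot_ge0 // !frob_dotE big_ord1 pair_big /=.
pose F (ij : 'I_r * 'I_r) (b : 'I_(vechN r)) : R := (vech_index ij.2 ij.1 == b)%:R * mu b 0 ^+ 2.
have -> : \sum_(ij : 'I_r * 'I_r) Mmat mu ij.2 ij.1 * Mmat mu ij.2 ij.1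
  = \sum_ij \sum_b F ij b.
  apply: eq_bigr => -[j i] _; rewrite !mxE /F /= -expr2.
  (* An entry whose index matched no coordinate would be zero, which settles that case without a
     range bound on [vech_index]. *)
  have [[b Eb]|nb] := pselect (exists b : 'I_(vechN r), vech_index i j = b); last first.
    rewrite !big1 ?expr0n // => b _; case: eqP => [E|]; rewrite ?mul0r //;
      by case: nb; exists b.
  have pick_b (G : 'I_(vechN r) -> R) :
      \sum_(c < vechN r) (vech_index i j == c)%:R * G c = G b.
    rewrite (bigD1 b) //= Eb eqxx mul1r big1 ?addr0 // => c.
    by rewrite eq_sym -val_eqE => /negPf ->; rewrite mul0r.
  by rewrite pick_b (pick_b (fun b => mu b 0 ^+ 2)).
rewrite exchange_big /=; apply: ler_sum => b _.
have [i [j E]] := vech_index_surj (ltn_ord b).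
rewrite (bigD1 (j, i)) //= /F /= E eqxx mul1r expr2 lerDl sumr_ge0 // => k _.
by rewrite mulr_ge0 ?ler0n ?sqr_ge0.
Qed.

End Vectorization.

(** * Resolvents of skew-symmetric matrices *)

Section Skew.
Variables (R : realType) (p : nat) (X : 'M[R]_p).
Hypothesis Xskew : X^T = - X.

(** Skewness makes Y and XY orthogonal, so |(I - X)Y|^2 = |Y|^2 + |XY|^2. *)
Lemma frob_skew_ge k (Y : 'M[R]_(p, k)) : frob Y <= frob ((1%:M - X) *m Y).
Proof.
rewrite -ler_sqr ?nnegrE ?frob_ge0 // !sqr_frob.
have XY : frob_dot Y (X *m Y) = 0.
  have : frob_dot Y (X *m Y) = - frob_dot Y (X *m Y).
    by rewrite -frob_dotNr -mulNmx -Xskew -frob_dotMl frob_dotC.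
  lra.
rewrite mulmxBl mul1mx -[- (X *m Y)]scaleN1r frob_dotDl !frob_dotDr.
rewrite !frob_dotZl !frob_dotZr (frob_dotC (X *m Y) Y) XY.
have := frob_dot_ge0 (X *m Y); lra.
Qed.

Lemma unitmx_1Bskew : 1%:M - X \in unitmx.
Proof.
apply: unitmx_injective => x x0; apply/eqP; rewrite -frob_eq0 eq_le frob_ge0 andbT.
by rewrite -[leRHS](frob0 R p 1) -x0 frob_skew_ge.
Qed.

Lemma frob_inv_1Bskew k (Y : 'M[R]_(p, k)) : frob (invmx (1%:M - X) *m Y) <= frob Y.
Proof. by rewrite -{2}[Y](mulKVmx unitmx_1Bskew) frob_skew_ge. Qed.

End Skew.

(** * Isometries and Gram matrices *)

Section Isometry.
Variable R : realType.

Lemma frob_isometry m n k (Q : 'M[R]_(m, n)) (Y : 'M[R]_(n, k)) :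
  Q^T *m Q = 1%:M -> frob (Q *m Y) = frob Y.
Proof. by move=> QQ; rewrite /frob frob_dotMl mulmxA QQ mul1mx. Qed.

(** From |x|^2 <= c <x, D^T D x> <= c |x| |D^T D x|, cancelling |x| gives injectivity and the bound
    on the inverse together. *)
Lemma gram_inverse_bound k n (D : 'M[R]_(k, n)) c : 0 <= c ->
  (forall x : 'cV[R]_n, frob x ^+ 2 <= c * frob (D *m x) ^+ 2) ->
  D^T *m D \in unitmx /\ opnorm2 (invmx (D^T *m D)) <= c.
Proof.
move=> c0 Dc.
have bound (x : 'cV[R]_n) : frob x <= c * frob ((D^T *m D) *m x).
  have [->|x0] := eqVneq x 0; first by rewrite mulmx0 !frob0 mulr0.
  rewrite -(ler_pM2r (frob_gt0 x0)) -expr2 (le_trans (Dc x)) // -mulrA ler_wpM2l //.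
  by rewrite sqr_frob frob_dotMl mulmxA mulrC frob_CauchySchwarz.
have Du : D^T *m D \in unitmx.
  apply: unitmx_injective => x x0; apply/eqP; rewrite -frob_eq0 eq_le frob_ge0 andbT.
  by have := bound x; rewrite x0 frob0 mulr0.
split=> //; apply: opnorm2_le => // x.
by rewrite (le_trans (bound _)) // mulKVmx.
Qed.

Lemma gram_width1 m n (A : 'M[R]_(m, n)) : n = 1%N ->
  A^T *m A = (opnorm2 A ^+ 2)%:M.
Proof.
move=> n1; subst n.
have frob1 : frob (1%:M : 'M[R]_1) = 1.
  by rewrite /frob /frob_dot mulmx1 trmx1 mxtrace1 sqrtr1.
have -> : opnorm2 A = frob A.
  apply/eqP; rewrite eq_le opnorm2_le ?frob_ge0 //=; last exact: frob_mulmx.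
  by have := opnorm2_bound A 1%:M; rewrite mulmx1 frob1 mulr1.
by rewrite sqr_frob /frob_dot [A^T *m A]mx11_scalar mxtrace_scalar mulr1n.
Qed.

End Isometry.

(** * Cayley parameterization and the derivative of Sigma *)

Section Cayley.
Variables (R : realType) (p r : nat).
Hypothesis le_rp : (r <= p)%N.

Let E := Ipr R p r.
Let T := Theta2 R p r.

(** E and T^T together form an orthonormal basis. Substituting p = r + (p - r) removes the
    [conform_mx] casts here once and for all; later arguments use only these identities. *)
Lemma Ipr_frame : [/\ E^T *m E = 1%:M, T *m T^T = 1%:M, T *m E = 0,
    E *m E^T + T^T *m T = 1%:M
  & forall A : 'M[R]_(p - r, r), Xphi A = T^T *m A *m E^T - E *m A^T *m T].
Proof.
rewrite /E /T /Ipr /Theta2 /Xphi.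
move: (p - r)%N (esym (subnKC le_rp)) => q def_p.
subst p; rewrite !conform_mx_id.
split.
- by rewrite tr_col_mx mul_row_col trmx1 trmx0 mul1mx mul0mx addr0.
- by rewrite tr_row_mx mul_row_col trmx1 trmx0 mul1mx mul0mx add0r.
- by rewrite mul_row_col mul0mx mulmx0 addr0.
- rewrite tr_col_mx tr_row_mx !mul_col_row !trmx1 !trmx0 !mul1mx !mul0mx.
  by rewrite add_block_mx !addr0 add0r -scalar_mx_block.
move=> A; rewrite conform_mx_id tr_col_mx tr_row_mx !mul_col_mx !mul_mx_row.
rewrite !trmx0 !trmx1 ?(mul0mx, mulmx0, mul1mx, mulmx1) -!block_mxEv.
by rewrite opp_block_mx add_block_mx !oppr0 !addr0 !add0r.
Qed.

Let EE : E^T *m E = 1%:M. Proof. by case: Ipr_frame. Qed.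
Let TT : T *m T^T = 1%:M. Proof. by case: Ipr_frame. Qed.
Let TE : T *m E = 0. Proof. by case: Ipr_frame. Qed.
Let ET : E^T *m T^T = 0. Proof. by rewrite -trmx_mul TE trmx0. Qed.
Let EETT : E *m E^T + T^T *m T = 1%:M. Proof. by case: Ipr_frame. Qed.
Let XphiE A : Xphi A = T^T *m A *m E^T - E *m A^T *m T.
Proof. by case: Ipr_frame. Qed.

Lemma Xphi_skew (A : 'M[R]_(p - r, r)) : (Xphi A)^T = - Xphi A.
Proof.
by rewrite XphiE linearB /= !trmx_mul !trmxK opprB !mulmxA.
Qed.

Lemma sqr_frob_split k (Y : 'M[R]_(p, k)) :
  frob Y ^+ 2 = frob (E^T *m Y) ^+ 2 + frob (T *m Y) ^+ 2.
Proof.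
rewrite !sqr_frob !frob_dotMl trmxK -frob_dotDr !mulmxA -mulmxDl EETT.
by rewrite mul1mx.
Qed.

Lemma frob_Ipr_tr k (Y : 'M[R]_(p, k)) : frob (E^T *m Y) <= frob Y.
Proof.
by rewrite -ler_sqr ?nnegrE ?frob_ge0 // (sqr_frob_split Y) lerDl sqr_ge0.
Qed.

(** The two off-diagonal blocks of a symmetric matrix are transposes of each other, whence the
    factor 2, the source of the square root of 2 in the theorem. The last diagonal block is
    dropped. *)
Lemma sqr_frob_blocks (Y : 'M[R]_p) : Y^T = Y ->
  frob (E^T *m Y *m E) ^+ 2 + 2 * frob (T *m Y *m E) ^+ 2 <= frob Y ^+ 2.
Proof.
move=> Ysym; rewrite sqr_frob_split -(frob_tr (E^T *m Y)) -(frob_tr (T *m Y)).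
rewrite (sqr_frob_split (E^T *m Y)^T) (sqr_frob_split (T *m Y)^T).
rewrite -!trmx_mul -{2}[T]trmxK -trmx_mul !frob_tr.
have -> : frob (E^T *m Y *m T^T) = frob (T *m Y *m E).
  by rewrite -frob_tr !trmx_mul !trmxK Ysym mulmxA.
have := sqr_ge0 (frob (T *m (T *m Y)^T)); lra.
Qed.

Lemma frob_Ipr k (Y : 'M[R]_(k, p)) : frob (Y *m E) <= frob Y.
Proof. by rewrite -frob_tr trmx_mul -(frob_tr Y) frob_Ipr_tr. Qed.

(** The matrix on the right is symmetric, and its blocks in the frame (E, T) are read off from N E =
    G + E (G^T E + S). *)
Lemma sqr_frob_tangent_ge (G : 'M[R]_(p, r)) (S : 'M[R]_r) : S^T = S ->
  frob (E^T *m G + (E^T *m G)^T + S) ^+ 2 + 2 * frob (T *m G) ^+ 2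
    <= frob (G *m E^T + (G *m E^T)^T + E *m S *m E^T) ^+ 2.
Proof.
move=> Ssym; set N := _ + E *m S *m E^T.
have Nsym : N^T = N.
  by rewrite /N !linearD /= trmxK !trmx_mul Ssym !trmxK mulmxA [X in X + _]addrC.
have NE : N *m E = G + E *m (G^T *m E + S).
  by rewrite /N trmx_mul trmxK !mulmxDl -!mulmxA EE !mulmx1 mulmxDr addrA.
apply: le_trans (sqr_frob_blocks Nsym); rewrite -!mulmxA NE !mulmxDr !mulmxA EE TE.
by rewrite !mul0mx !addr0 !mul1mx addrA trmx_mul trmxK.
Qed.

Lemma frob_Xphi_le (B : 'M[R]_(p - r, r)) : frob (Xphi B) <= 2 * frob B.
Proof.
have TBE : frob (T^T *m B *m E^T) = frob B.
  rewrite -mulmxA frob_isometry ?trmxK //.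
  by rewrite -frob_tr trmx_mul trmxK frob_isometry ?frob_tr.
rewrite XphiE (_ : E *m B^T *m T = (T^T *m B *m E^T)^T); last first.
  by rewrite !trmx_mul !trmxK mulmxA.
by rewrite (le_trans (ler_frobD _ _)) // frobN frob_tr TBE mulr_natl.
Qed.

Section Derivative.
Variables (A : 'M[R]_(p - r, r)) (mu : 'cV[R]_(vechN r)).
Let C := invmx (1%:M - Xphi A).
Let Q := (1%:M + Xphi A) *m C.
Let M := Mmat mu.
Let a := opnorm2 A ^+ 2.
Let Z (B : 'M[R]_(p - r, r)) := 2 *: (C^T *m Xphi B *m C).

Let u1X : 1%:M - Xphi A \in unitmx.
Proof. exact/unitmx_1Bskew/Xphi_skew. Qed.

Let tr1X : (1%:M - Xphi A)^T = 1%:M + Xphi A.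
Proof. by rewrite linearB /= trmx1 Xphi_skew opprK. Qed.

Let trC1X : C^T *m (1%:M + Xphi A) = 1%:M.
Proof. by rewrite -tr1X -trmx_mul mulmxV // trmx1. Qed.

Let mul1XtrC : (1%:M + Xphi A) *m C^T = 1%:M.
Proof. by rewrite -tr1X -trmx_mul mulVmx // trmx1. Qed.

Let comm1X : (1%:M - Xphi A) *m (1%:M + Xphi A) = (1%:M + Xphi A) *m (1%:M - Xphi A).
Proof.
by rewrite [LHS]mulmxBl [RHS]mulmxBr mul1mx mulmx1 mulmxDr mulmxDl mulmx1 mul1mx.
Qed.

Let trQQ : Q^T *m Q = 1%:M.
Proof.
rewrite trmx_mul -tr1X trmxK /Q -mulmxA [X in C^T *m X]mulmxA comm1X.
by rewrite -mulmxA mulmxV // mulmx1 trC1X.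
Qed.

(** I - X and I + X commute, so Q = C (I + X), and C^T inverts I + X. This lets the left factor C of
    the derivative be traded for Q C^T, which brings out [Z]. *)
Let QtrC : Q *m C^T = C.
Proof.
have -> : Q = C *m (1%:M + Xphi A).
  apply: (can_inj (mulKmx u1X)); rewrite mulKVmx // /Q mulmxA comm1X.
  by rewrite -mulmxA mulmxV // mulmx1.
by rewrite -mulmxA mul1XtrC mulmx1.
Qed.

(** The Kronecker factor sends vec B to vec (T^T B E^T), and I - K subtracts the transpose. *)
Lemma Gamma_vec (B : 'M[R]_(p - r, r)) : Gamma R p r *m vec B = vec (Xphi B).
Proof.
rewrite -mulmxA tensmx_vec mulmxBl mul1mx commat_vec -linearB /=.
by rewrite !trmx_mul /Theta1 !trmxK XphiE mulmxA.
Qed.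

Lemma DU_vec (B : 'M[R]_(p - r, r)) :
  DU A *m vec B = vec (2 *: (C *m Xphi B *m C *m E)).
Proof.
rewrite /DU -(mulmxA _ (Gamma R p r)) Gamma_vec -scalemxAl tensmx_vec -linearZ /=.
by rewrite trmx_mul !trmxK !mulmxA.
Qed.

Lemma DphiSigma_vec (B : 'M[R]_(p - r, r)) :
  DphiSigma A mu *m vec B =
  vec (Q *m (Z B *m E *m M *m E^T + (Z B *m E *m M *m E^T)^T) *m Q^T).
Proof.
rewrite /DphiSigma -(mulmxA _ (DU A)) DU_vec -(mulmxA (1%:M + _)) tensmx_vec.
rewrite mulmxDl !mul1mx commat_vec -linearD /=; congr vec.
rewrite mulmxDr mulmxDl.
have -> : 2 *: (C *m Xphi B *m C *m E) *m (Ucay A *m Mmat mu)^T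
    = Q *m (Z B *m E *m M *m E^T) *m Q^T.
  rewrite /Ucay -/E -/C -/Q trmx_mul Mmat_tr trmx_mul.
  by rewrite -{1}QtrC /Z -!scalemxAl -!scalemxAr -!scalemxAl !mulmxA.
by congr (_ + _); rewrite [in LHS]trmx_mul trmxK [in LHS]trmx_mul mulmxA.
Qed.

Lemma DmuSigma_vec (m : 'cV[R]_(vechN r)) :
  DmuSigma A *m m = vec (Q *m (E *m Mmat m *m E^T) *m Q^T).
Proof.
rewrite /DmuSigma -(mulmxA (_ *t _)) dupmat_vech tensmx_vec /Ucay -/E -/C -/Q.
by rewrite trmx_mul !mulmxA.
Qed.

Let W (B : 'M[R]_(p - r, r)) := T *m (C^T *m Xphi B *m C) *m E.

Let X_E : Xphi A *m E = T^T *m A.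
Proof.
by rewrite XphiE mulmxBl -!mulmxA EE TE !mulmx0 mulmx1 subr0.
Qed.

Let X_T : Xphi A *m T^T = - (E *m A^T).
Proof.
by rewrite XphiE mulmxBl -!mulmxA ET TT !mulmx0 mulmx1 sub0r.
Qed.

(** Multiplying by I - X reduces this to the images of E and T^T under X: the terms T^T A cancel. *)
Let CE_gram : C *m E *m (1%:M + A^T *m A) = E + T^T *m A.
Proof.
apply: (can_inj (mulKmx u1X)); rewrite -!mulmxA mulKVmx //.
rewrite mulmxBl mul1mx [in RHS]mulmxDr X_E mulmxA X_T mulNmx opprD opprK.
by rewrite addrA addrK mulmxDr mulmx1 mulmxA.
Qed.

Let gram_TC : (1%:M + A *m A^T) *m T *m C^T = T - A *m E^T.
Proof.
have h : C *m T^T *m (1%:M + A *m A^T) = T^T - E *m A^T.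
  apply: (can_inj (mulKmx u1X)); rewrite -!mulmxA mulKVmx //.
  rewrite mulmxBl mul1mx [in RHS]mulmxBr mulmxA X_E X_T.
  rewrite mulmxDr mulmx1 opprB opprK mulmxA.
  by rewrite [X in _ = _ + X]addrC addrA subrK.
apply: trmx_inj; rewrite linearB /= !trmx_mul !trmxK -h.
by rewrite linearD /= trmx1 trmx_mul trmxK !mulmxA.
Qed.

(** The outer factors are absorbed by [gram_TC] and [CE_gram], leaving (T - A E^T) X_B (E + T^T A).
    The two summands of X_B then contribute B and A B^T A. *)
Lemma cayley_block_eq (B : 'M[R]_(p - r, r)) :
  (1%:M + A *m A^T) *m W B *m (1%:M + A^T *m A) = B + A *m B^T *m A.
Proof.
have -> : (1%:M + A *m A^T) *m W B *m (1%:M + A^T *m A)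
    = (T - A *m E^T) *m Xphi B *m (E + T^T *m A).
  by rewrite -CE_gram -gram_TC /W !mulmxA.
have lT : (T - A *m E^T) *m T^T = 1%:M.
  by rewrite mulmxBl TT -mulmxA ET mulmx0 subr0.
have lE : (T - A *m E^T) *m E = - A by rewrite mulmxBl TE -mulmxA EE mulmx1 sub0r.
have rE : E^T *m (E + T^T *m A) = 1%:M by rewrite mulmxDr EE mulmxA ET mul0mx addr0.
have rT : T *m (E + T^T *m A) = A by rewrite mulmxDr TE mulmxA TT mul1mx add0r.
rewrite XphiE mulmxBr mulmxBl !mulmxA lT lE mul1mx -!mulmxA rE rT.
by rewrite mulmx1 mulNmx opprK.
Qed.

Lemma opnorm2_gram k (Y : 'M[R]_(r, k)) :
  frob ((1%:M + A^T *m A) *m Y) <= (1 + a) * frob Y.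
Proof.
rewrite mulmxDl mul1mx mulrDl mul1r (le_trans (ler_frobD _ _)) // lerD2l.
rewrite -mulmxA (le_trans (opnorm2_trmx_mulmx _ _)) // /a expr2 -mulrA.
by rewrite ler_wpM2l ?opnorm2_ge0 ?opnorm2_mulmx.
Qed.

Lemma opnorm2_gramT k (Y : 'M[R]_(p - r, k)) :
  frob ((1%:M + A *m A^T) *m Y) <= (1 + a) * frob Y.
Proof.
rewrite mulmxDl mul1mx mulrDl mul1r (le_trans (ler_frobD _ _)) // lerD2l.
rewrite -mulmxA (le_trans (opnorm2_mulmx _ _)) // /a expr2 -mulrA.
by rewrite ler_wpM2l ?opnorm2_ge0 ?opnorm2_trmx_mulmx.
Qed.

Let a0 : 0 <= a. Proof. exact: sqr_ge0. Qed.

(** In [cayley_block_eq] the right side has norm at least (1 - a) |B|, and each of the two outer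
    factors on the left enlarges the norm by at most 1 + a. *)
Lemma cayley_block_ge (B : 'M[R]_(p - r, r)) :
  (1 - a) / (1 + a) ^+ 2 * frob B <= frob (W B).
Proof.
have a1 : 0 < 1 + a by rewrite ltr_pwDl.
rewrite mulrAC ler_pdivrMr ?exprn_gt0 //.
apply: (@le_trans _ _ (frob (B + A *m B^T *m A))).
  rewrite mulrBl mul1r lerBlDr.
  have : frob B <= frob (B + A *m B^T *m A) + frob (- (A *m B^T *m A)).
    by rewrite -{1}[B](addrK (A *m B^T *m A)) ler_frobD.
  move=> /le_trans; apply; rewrite lerD2l frobN -mulmxA.
  rewrite (le_trans (opnorm2_mulmx _ _)) // /a expr2 -mulrA ler_wpM2l ?opnorm2_ge0 //.
  by rewrite (le_trans (opnorm2_mulmxr _ _)) // frob_tr.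
rewrite -cayley_block_eq -mulmxA (le_trans (opnorm2_gramT _)) //.
rewrite mulrC expr2 mulrA ler_wpM2r ?(ltW a1) // -frob_tr trmx_mul.
rewrite raddfD /= trmx1 trmx_mul trmxK mulrC -(frob_tr (W B)).
exact: opnorm2_gram.
Qed.

(** For r = 1 the scalar B^T A equals A^T B, so B + A B^T A = (I + A A^T) B. The left factor cancels
    exactly, and A^T A = a leaves (1 + a) W = B. *)
Lemma cayley_block_rank1_eq (B : 'M[R]_(p - r, r)) : r = 1%N ->
  frob (W B) = frob B / (1 + a).
Proof.
move=> r1; have a1 : 0 < 1 + a by rewrite ltr_pwDl.
have gram : A^T *m A = a%:M by exact: gram_width1.
have BA : B^T *m A = A^T *m B.
  rewrite -[LHS](trmxK) trmx_mul trmxK.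
  by move: (A^T *m B); rewrite r1 => Y; rewrite [Y]mx11_scalar tr_scalar_mx.
have gramT_inj (Y : 'M[R]_(p - r, r)) : (1%:M + A *m A^T) *m Y = 0 -> Y = 0.
  move=> Y0; apply/eqP; rewrite -frob_dot_eq0 eq_le frob_dot_ge0 andbT.
  have : frob_dot Y ((1%:M + A *m A^T) *m Y) = 0.
    by rewrite Y0 /frob_dot mulmx0 mxtrace0.
  rewrite mulmxDl mul1mx frob_dotDr -mulmxA -[A in A *m (_ *m _)]trmxK -frob_dotMl.
  by have := frob_dot_ge0 (A^T *m Y); lra.
have : (1%:M + A *m A^T) *m ((1 + a) *: W B - B) = 0.
  rewrite mulmxBr -scalemxAr -mul_mx_scalar raddfD /= -gram cayley_block_eq.
  by rewrite mulmxDl mul1mx -!mulmxA BA subrr.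
move/gramT_inj/eqP; rewrite subr_eq0 => /eqP defB.
by rewrite -[in RHS]defB frobZ gtr0_norm // mulrC mulKf // gt_eqF.
Qed.

Let rotate (Y : 'M[R]_p) : frob (Q *m Y *m Q^T) = frob Y.
Proof.
rewrite -mulmxA frob_isometry ?trQQ // -frob_tr trmx_mul trmxK.
by rewrite frob_isometry ?trQQ // frob_tr.
Qed.

Let G (B : 'M[R]_(p - r, r)) := Z B *m E *m M.

Lemma DSigma_vec (B : 'M[R]_(p - r, r)) (m : 'cV[R]_(vechN r)) :
  DSigma A mu *m col_mx (vec B) m = vec (Q *m
    (G B *m E^T + (G B *m E^T)^T + E *m Mmat m *m E^T) *m Q^T).
Proof.
rewrite /DSigma mul_row_col DphiSigma_vec DmuSigma_vec -linearD /=.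
by rewrite -mulmxDl -mulmxDr.
Qed.

(** * Lower bounds for the derivative, given a bound on the off-diagonal block *)

Section LowerBound.
Hypothesis r_gt0 : (0 < r)%N.
Variable c : R.
Hypothesis c_ge0 : 0 <= c.
Hypothesis cW : forall B : 'M[R]_(p - r, r), c * frob B <= frob (W B).
(** The factor 2 comes from [Z], the square root of 2 from the pair of off-diagonal blocks. Keeping
    [c] abstract treats r = 1 and r >= 2 together. *)
Let L := 2 * Num.sqrt 2 * fine (sigma_min M) * c.

Lemma DSigma_ge (B : 'M[R]_(p - r, r)) (m : 'cV[R]_(vechN r)) :
  frob (E^T *m G B + (E^T *m G B)^T + Mmat m) ^+ 2 + (L * frob B) ^+ 2
    <= frob (DSigma A mu *m col_mx (vec B) m) ^+ 2.
Proof.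
rewrite DSigma_vec frob_vec rotate.
apply: le_trans (sqr_frob_tangent_ge _ (Mmat_tr m)); rewrite lerD2l.
have s0 := fine_sigma_min_ge0 M r_gt0; set s := fine _ in s0.
(* M multiplies on the right; transposing, with M symmetric, moves it to the left, where the
   singular value bound applies. *)
have WM : s * c * frob B <= frob (W B *m M).
  rewrite -mulrA (@le_trans _ _ (s * frob (W B))) ?ler_wpM2l //.
  rewrite -(frob_tr (W B)) -(frob_tr (W B *m M)) (trmx_mul (W B)) [M^T]Mmat_tr.
  by apply: frob_mulmx_ge => // x; exact: sigma_min_le.
have -> : T *m G B = 2 *: (W B *m M).
  by rewrite /G /Z /W -!scalemxAl -scalemxAr !mulmxA.
rewrite frobZ ger0_norm // /L -/s.
have -> : (2 * Num.sqrt 2 * s * c * frob B) ^+ 2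
    = 2 * (2 * (s * c * frob B)) ^+ 2.
  by rewrite !exprMn sqr_sqrtr // /=; ring.
by rewrite ler_pM2l // !exprMn ler_pM2l // -!exprMn ler_sqr ?nnegrE ?mulr_ge0 ?frob_ge0.
Qed.

Lemma DphiSigma_ge (x : 'cV[R]_(r * (p - r))) :
  L * frob x <= frob (DphiSigma A mu *m x).
Proof.
have := DSigma_ge (unvec x) 0; rewrite unvecK /DSigma mul_row_col mulmx0 addr0.
move=> h; rewrite -ler_sqr ?nnegrE ?frob_ge0 //; last first.
  by rewrite !mulr_ge0 ?frob_ge0 ?sqrtr_ge0 // fine_sigma_min_ge0.
apply: le_trans h; rewrite -(frob_vec (unvec x)) unvecK lerDr sqr_ge0 //.
Qed.

(** The constant 4 is the 2 in [Z] times the 2 in [frob_Xphi_le]; C, C^T and the compressions by E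
    do not increase the norm. *)
Lemma tangent_block_le (B : 'M[R]_(p - r, r)) :
  frob (E^T *m G B) <= 4 * opnorm2 M * frob B.
Proof.
rewrite /G !mulmxA (le_trans (opnorm2_mulmxr _ _)) //.
rewrite [4 * _]mulrC -mulrA ler_wpM2l ?opnorm2_ge0 //.
rewrite (le_trans (frob_Ipr _)) // (le_trans (frob_Ipr_tr _)) // /Z frobZ ger0_norm //.
have -> : 4 * frob B = 2 * (2 * frob B) by ring.
rewrite ler_pM2l // (le_trans _ (frob_Xphi_le B)) //.
have Xs : (Xphi A)^T^T = - (Xphi A)^T by rewrite Xphi_skew raddfN /= Xphi_skew.
have Ctr : C^T = invmx (1%:M - (Xphi A)^T) by rewrite trmx_inv linearB /= trmx1.
rewrite -mulmxA {1}Ctr (le_trans (frob_inv_1Bskew Xs _)) //.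
rewrite -frob_tr trmx_mul Ctr (le_trans (frob_inv_1Bskew Xs _)) //.
by rewrite frob_tr.
Qed.

Hypothesis L_gt0 : 0 < L.

(** Put t = L b and e = 8 |M| / L. The diagonal block gives d <= u + e t, hence d^2 <= (1 + e^2)(u^2
    + t^2), while b^2 = t^2 / L^2; adding yields 1 + e^2 + 1 / L^2. *)
Lemma DSigma_inverse_ge (x : 'cV[R]_(r * (p - r) + vechN r)) :
  frob x ^+ 2 <= (1 + (1 + 64 * opnorm2 M ^+ 2) / L ^+ 2)
    * frob (DSigma A mu *m x) ^+ 2.
Proof.
rewrite -[x]vsubmxK; set y := usubmx x; set m := dsubmx x.
have -> : frob (col_mx y m) ^+ 2 = frob y ^+ 2 + frob m ^+ 2.
  by rewrite !sqr_frob /frob_dot tr_col_mx mul_row_col mxtraceD.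
have := DSigma_ge (unvec y) m; rewrite unvecK -(frob_vec (unvec y)) unvecK.
set b := frob y; set d := frob m; set D := frob (DSigma _ _ *m _).
set u := frob (_ + _ + _) => D_ge.
(* The 8 is twice the 4 of [tangent_block_le], since the block and its transpose are both
   subtracted. *)
have c8 : d <= u + 8 * opnorm2 M * b.
  apply: le_trans (frob_Mmat_ge m) _.
  have := tangent_block_le (unvec y); rewrite -(frob_vec (unvec y)) unvecK -/b.
  move: @u D_ge; set H := E^T *m _ => u D_ge H_le.
  rewrite -[Mmat m](addKr (H + H^T)) addrC.
  rewrite (le_trans (ler_frobD _ _)) // frobN lerD2l.
  rewrite (le_trans (ler_frobD _ _)) // frob_tr; lra.
clearbody L; set e := 8 * opnorm2 M / L.
have de : d <= u + e * (L * b).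
  by rewrite /e mulrA divfK ?gt_eqF.
have e0 : 0 <= e.
  by apply: divr_ge0 (ltW L_gt0); rewrite mulr_ge0 ?opnorm2_ge0.
have b0 : 0 <= b by exact: frob_ge0.
have d0 : 0 <= d by exact: frob_ge0.
have u0 : 0 <= u by exact: frob_ge0.
have -> : 1 + (1 + 64 * opnorm2 M ^+ 2) / L ^+ 2 = 1 + e ^+ 2 + L ^- 2.
  by rewrite /e; field; rewrite gt_eqF.
have bL : b ^+ 2 = L ^- 2 * (L * b) ^+ 2.
  by rewrite exprMn mulKf // expf_neq0 // gt_eqF.
rewrite bL; move: (L * b) (mulr_ge0 (ltW L_gt0) b0) de D_ge => t t0 de D_ge.
have d2 : d ^+ 2 <= (1 + e ^+ 2) * (u ^+ 2 + t ^+ 2).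
  apply: (@le_trans _ _ ((u + e * t) ^+ 2)).
    by rewrite ler_sqr ?nnegrE // addr_ge0 // mulr_ge0.
  (* This square is exactly the gap in Cauchy-Schwarz for (1, e) and (u, t). *)
  have := sqr_ge0 (e * u - t); lra.
have L2 : 0 <= L ^- 2 by rewrite invr_ge0 sqr_ge0.
rewrite mulrDl addrC lerD //.
  by rewrite (le_trans d2) // ler_wpM2l // addr_ge0 // sqr_ge0.
by rewrite ler_wpM2l // (le_trans _ D_ge) // lerDr sqr_ge0.
Qed.

End LowerBound.
End Derivative.
End Cayley.

(** * Assembly of the two bounds *)

Theorem theorem6 (R : realType) (p r : nat) (hr : (1 <= r <= p)%N)
  (A0 : 'M[R]_(p - r, r)) (mu0 : 'cV[R]_(vechN r))
  (hA0 : opnorm2 A0 < 1)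
  (hM0 : Mmat mu0 \in unitmx) :
  let M0 := Mmat mu0 in
  let a := opnorm2 A0 ^+ 2 in
  let D := DSigma A0 mu0 in
  ((if (2 <= r)%N then
      2%:R * Num.sqrt 2%:R * fine (sigma_min M0) * (1 - a) / (1 + a) ^+ 2
    else 2%:R * Num.sqrt 2%:R * fine (sigma_min M0) / (1 + a))%:E
     <= sigma_min (DphiSigma A0 mu0))%E
  /\ (D^T *m D \in unitmx)
  /\ opnorm2 (invmx (D^T *m D)) <=
     (if (2 <= r)%N then
        1 + (1 + 64%:R * opnorm2 M0 ^+ 2) * (1 + a) ^+ 4
            / (8%:R * lambda_min_abs M0 ^+ 2 * (1 - a) ^+ 2)
      else
        1 + (1 + 64%:R * opnorm2 M0 ^+ 2) * (1 + a) ^+ 2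
            / (8%:R * lambda_min_abs M0 ^+ 2)).
Proof.
move=> M0 a D; have /andP [r_gt0 le_rp] := hr.
have a_ge0 : 0 <= a by exact: sqr_ge0.
have a_lt1 : a < 1 by rewrite /a expr_lt1 ?opnorm2_ge0.
have aD : 0 < 1 + a by rewrite ltr_pwDl.
have aB : 0 < 1 - a by rewrite subr_gt0.
have s_gt0 : 0 < fine (sigma_min M0) by exact: fine_sigma_min_gt0.
have -> : lambda_min_abs M0 = fine (sigma_min M0).
  by rewrite lambda_min_absE // Mmat_tr.
pose c := if (2 <= r)%N then (1 - a) / (1 + a) ^+ 2 else (1 + a)^-1.
have c_gt0 : 0 < c.
  by rewrite /c; case: ifP => _; rewrite ?invr_gt0 ?divr_gt0 // exprn_gt0.
have cW (B : 'M[R]_(p - r, r)) : c * frob B <= frob (Theta2 R p r *m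
    ((invmx (1%:M - Xphi A0))^T *m Xphi B *m invmx (1%:M - Xphi A0)) *m Ipr R p r).
  rewrite /c; case: ifP => [_|r2]; first exact: cayley_block_ge.
  have r1 : r = 1%N by apply/anti_leq; rewrite r_gt0 andbT leqNgt r2.
  by rewrite (cayley_block_rank1_eq le_rp A0 B r1) mulrC.
pose L := 2 * Num.sqrt 2 * fine (sigma_min M0) * c.
have L_gt0 : 0 < L by rewrite !mulr_gt0 // sqrtr_gt0.
have L2 : L ^+ 2 = 8 * (fine (sigma_min M0) * c) ^+ 2.
  by rewrite /L !exprMn sqr_sqrtr //; ring.
have [Du Dle] : D^T *m D \in unitmx /\
    opnorm2 (invmx (D^T *m D)) <= 1 + (1 + 64 * opnorm2 M0 ^+ 2) / L ^+ 2.
  apply: gram_inverse_bound => [|x]; last exact: DSigma_inverse_ge (ltW c_gt0) cW L_gt0 x.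
  by rewrite addr_ge0 // divr_ge0 ?sqr_ge0 // addr_ge0 // mulr_ge0 ?sqr_ge0.
split; last split=> //.
  have -> : (if (2 <= r)%N
      then 2 * Num.sqrt 2 * fine (sigma_min M0) * (1 - a) / (1 + a) ^+ 2
      else 2 * Num.sqrt 2 * fine (sigma_min M0) / (1 + a)) = L.
    by rewrite /L /c; case: ifP; rewrite ?mulrA.
  by apply: sigma_min_ge => x; exact: DphiSigma_ge (ltW c_gt0) cW x.
(* With L^2 = 8 s^2 c^2, the bound obtained equals the stated one in both cases. *)
apply: le_trans Dle _; rewrite L2 /c le_eqVlt; apply/orP; left; apply/eqP.
by case: ifP => _; field; rewrite ?gt_eqF.
Qed.
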